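(* Let $G$ be a group and let $R$ be a $G$-graded ring. If $(R,G)$ is strong, then $(R,G)$ is weak.
   Context: A ring $R$ with unity $1$ is $G$-graded if $R=\bigoplus_{g\in G}R_g$ for additive subgroups $R_g$ with $R_gR_h\subseteq R_{gh}$ for all $g,h\in G$, where $R_gR_h$ denotes the additive subgroup generated by the products $ab$, $a\in R_g$, $b\in R_h$. $(R,G)$ is strong if $R_gR_h=R_{gh}$ for all $g,h\in G$. $(R,G)$ is weak if for every $g\in G$, $R_g=\{0\}$ implies $R_{g^{-1}}=\{0\}$. *)

(* Defs.v *)
From HB Require Import structures.
From mathcomp Require Import all_boot all_algebra.
From mathcomp Require Import boolp classical_sets.

Set Implicit Arguments.
Unset Strict Implicit.
Unset Printing Implicit Defensive.

Import GRing.Theory.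

Local Open Scope classical_set_scope.
Local Open Scope ring_scope.

Definition additive_subgroup (V : zmodType) (A : set V) : Prop :=
  zmod_closed [in A].

(* V is the internal direct sum of the A g. The group G may be infinite, so a
   sum over G is a sum over a duplicate-free finite sequence of indices. *)
Definition direct_sum_decomposition (V : zmodType) (G : choiceType)
    (A : G -> set V) : Prop :=
  (forall r : V, exists (s : seq G) (x : G -> V),
      [/\ uniq s, forall g, A g (x g) & r = \sum_(g <- s) x g]) /\
  (forall (s : seq G) (x : G -> V),
      uniq s -> (forall g, A g (x g)) -> \sum_(g <- s) x g = 0 ->
      forall g, g \in s -> x g = 0).

Definition subgroup_mul (R : pzRingType) (A B : set R) : set R :=
  smallest (@additive_subgroup R) [set a * b | a in A & b in B].

Definition graded (G : groupType) (R : pzRingType) (A : G -> set R) : Prop :=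
  [/\ forall g, additive_subgroup (A g),
      direct_sum_decomposition A
    & forall g h, subgroup_mul (A g) (A h) `<=` A (g * h)%g].

Definition strong (G : groupType) (R : pzRingType) (A : G -> set R) : Prop :=
  forall g h, subgroup_mul (A g) (A h) = A (g * h)%g.

Definition weak (G : groupType) (R : pzRingType) (A : G -> set R) : Prop :=
  forall g, A g = [set 0] -> A (g^-1)%g = [set 0].

(* Main.v *)
Require Import Defs.
From mathcomp Require Import all_boot all_algebra.
From mathcomp Require Import boolp classical_sets.

(** The zero component spreads through the identity: if $R_g=0$, strongness gives
    $R_1=R_gR_{g^{-1}}=0$, and then $R_{g^{-1}}=R_1R_{g^{-1}}=0$. Both steps rest on
    [subgroup_mul0l]. *)

Lemma additive_subgroup_set0 (V : zmodType) :
  additive_subgroup ([set 0%R] : set V)%classic.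
Proof.
split=> [|x y]; first exact/mem_set.
by move=> /set_mem -> /set_mem ->; apply/mem_set; rewrite /= GRing.subr0.
Qed.

Lemma subgroup_mul0l (R : pzRingType) (B : set R) :
  subgroup_mul [set 0%R]%classic B = [set 0%R]%classic.
Proof.
apply/seteqP; split=> [x|_ -> C [[/set_mem C0 _] _] //].
(* [smallest] is an intersection, so membership is tested on one candidate: the subgroup [[set 0]],
   which contains every product [0 * b]. *)
apply; split; first exact: additive_subgroup_set0.
by move=> _ [_ -> [b _ <-]]; rewrite /= GRing.mul0r.
Qed.

Theorem corollary2p17 (G : groupType) (R : pzRingType) (A : G -> set R)
  (hA : graded A) : strong A -> weak A.
Proof.
move=> strongA g Ag0.
have A1 : A 1%g = [set 0%R]%classic.
  by rewrite -(mulgV g) -strongA Ag0 subgroup_mul0l.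
by rewrite -(mul1g g^-1%g) -strongA A1 subgroup_mul0l.
Qed.
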